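(* Let $L$ be a planar finite distributive lattice, and let $d$ be the number of cells in the corresponding skew shape $\lambda/\mu$. The Hilbert series of the chain algebra $K[\mathcal{C}_L]$, graded so that its generating monomials have degree one, is $$\frac{\sum_{\mathcal{T}}z^{\operatorname{asc}(\mathcal{T})}}{(1-z)^{d+1}},$$ where the sum is taken over all standard Young tableaux $\mathcal{T}$ of the skew shape $\lambda/\mu$.
   Context: An ideal of a finite poset $P$ is a downward closed subset; $\mathcal{J}(P)$ is the lattice of ideals ordered by inclusion. Every finite distributive lattice is $\cong\mathcal{J}(P)$ for a finite poset $P$ unique up to isomorphism. $L=\mathcal{J}(P)$ is planar if $P$ has width (size of the largest antichain) at most $2$. Chain algebra: regard the elements of $L$ as variables over a field $K$; to a maximal chain $C$ of $L$ associate the monomial $t_C$ which is the product of its elements. $K[\mathcal{C}_L]$ is the $K$-subalgebra of the polynomial ring generated by all $t_C$, $C$ a maximal chain of $L$, with $\deg t_C=1$. Skew shape: for planar $L=\mathcal{J}(P)$ write $P=A\sqcup B$ as a disjoint union of two chains $A=\{1\prec\cdots\prec a\}$ and $B=\{1'\prec\cdots\prec b'\}$ (with possibly further relations between $A$ and $B$ in $P$). For $p\in P$ let $(p)$ be the smallest ideal of $P$ containing $p$. For $i=1,\ldots,b$ set $\mu_i=|A\cap(i')|$ and $\lambda_i=\max\{k\in A: i'\notin(k)\}$ (with $\lambda_i=0$ if there is no such $k$). Consider the $a\times b$ rectangle of unit cells with bottom left corner $(0,0)$ and top right corner $(a,b)$, rows numbered $1$ (bottom) to $b$ (top) and columns $1$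 (left) to $a$ (right). The skew shape $\lambda/\mu$ is the set of cells in row $i$ and column $j$ with $\mu_i<j\le\lambda_i$; equivalently the cells between the upper-left-most and lower-right-most lattice paths from $(0,0)$ to $(a,b)$ given by maximal chains of $L$, where an ideal $I$ is identified with the point $(|I\cap A|,|I\cap B|)$. A standard Young tableau of $\lambda/\mu$ is a bijective filling of its $d$ cells with the numbers $1,\ldots,d$ which is increasing from left to right along rows and downwards along columns. An index $i$ is an ascent of $\mathcal{T}$ if $i+1$ sits in a row (strictly) above the row of $i$; $\operatorname{asc}(\mathcal{T})$ is the number of ascents of $\mathcal{T}$. *)

(* Defs.v *)
From mathcomp Require Import all_boot all_order all_algebra.
From mathcomp Require Import mpoly.

Set Implicit Arguments.
Unset Strict Implicit.
Unset Printing Implicit Defensive.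

Import Order.TTheory GRing.Theory Num.Theory.
Local Open Scope ring_scope.

(** * Ideals, width, planarity *)

Definition is_ideal (dP : Order.disp_t) (P : finPOrderType dP) (I : {set P}) : bool :=
  [forall x in I, forall y, (y <= x)%O ==> (y \in I)].

Definition principal_ideal (dP : Order.disp_t) (P : finPOrderType dP) (p : P) : {set P} :=
  \bigcap_(I : {set P} | is_ideal I && (p \in I)) I.

(* [f] is an isomorphism of ordered sets (hence of lattices) from L onto J(P). *)
Definition iso_ideal_lattice (dL dP : Order.disp_t)
    (L : finTBDistrLatticeType dL) (P : finPOrderType dP) (f : L -> {set P}) : Prop :=
  [/\ forall x, is_ideal (f x),
      forall I, is_ideal I -> exists x, f x = I
    & forall x y, (f x \subset f y) = (x <= y)%O].

Definition is_antichain (dP : Order.disp_t) (P : finPOrderType dP) (S : {set P}) : bool :=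
  [forall x in S, forall y in S, (x >=< y)%O ==> (x == y)].

Definition width (dP : Order.disp_t) (P : finPOrderType dP) : nat :=
  \max_(S : {set P} | is_antichain S) #|S|.

(* P is the disjoint union of A = {alpha 0 < ... < alpha (a-1)} and
   B = {beta 0 < ... < beta (b-1)}.  Indices are shifted by one: [alpha k] is
   the element k+1 of A, and [beta i] is the element (i+1)' of B. *)
Definition chain_partition (dP : Order.disp_t) (P : finPOrderType dP) (a b : nat)
    (alpha : 'I_a -> P) (beta : 'I_b -> P) : Prop :=
  [/\ forall k l : 'I_a, (k < l)%N -> (alpha k < alpha l)%O,
      forall i j : 'I_b, (i < j)%N -> (beta i < beta j)%O,
      forall k i, alpha k != beta i
    & forall p, (exists k, p = alpha k) \/ (exists i, p = beta i)].

(** * Skew shapes and standard Young tableaux *)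

Section SkewShape.
Variables (dP : Order.disp_t) (P : finPOrderType dP) (a b : nat).
Variables (alpha : 'I_a -> P) (beta : 'I_b -> P).

Definition skew_mu (i : 'I_b) : nat :=
  #|[set alpha k | k : 'I_a] :&: principal_ideal (beta i)|.

(* The maximum of the 1-based index k.+1; it is 0 when no k qualifies. *)
Definition skew_lambda (i : 'I_b) : nat :=
  \max_(k < a | beta i \notin principal_ideal (alpha k)) k.+1.

(* The pair (i, j) is the cell in row i+1 from the bottom and column j+1 from
   the left. *)
Definition skew_shape : {set 'I_b * 'I_a} :=
  [set c : 'I_b * 'I_a | (skew_mu c.1 < c.2.+1 <= skew_lambda c.1)%N].

End SkewShape.

Definition cell (a b : nat) (S : {set 'I_b * 'I_a}) : finType :=
  {c : 'I_b * 'I_a | c \in S}.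

Definition cell_row (a b : nat) (S : {set 'I_b * 'I_a}) (c : cell S) : 'I_b := (val c).1.
Definition cell_col (a b : nat) (S : {set 'I_b * 'I_a}) (c : cell S) : 'I_a := (val c).2.

(* A filling of the cells of S; the value v : 'I_#|S| stands for the number
   v+1 in {1, ..., #|S|}. *)
Definition filling (a b : nat) (S : {set 'I_b * 'I_a}) : finType :=
  {ffun cell S -> 'I_#|S|}.

(* Rows are numbered from the bottom, so "increasing downwards" means
   decreasing in the row index. *)
Definition is_SYT (a b : nat) (S : {set 'I_b * 'I_a}) (T : filling S) : bool :=
  [&& injectiveb T,
      [forall v, v \in codom T],
      [forall c : cell S, forall c' : cell S,
         (cell_row c == cell_row c') && (cell_col c < cell_col c')%N ==> (T c < T c')%N]
    & [forall c : cell S, forall c' : cell S,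
         (cell_col c == cell_col c') && (cell_row c' < cell_row c)%N ==> (T c < T c')%N]].

Definition asc (a b : nat) (S : {set 'I_b * 'I_a}) (T : filling S) : nat :=
  #|[set v : 'I_#|S| | [exists c : cell S, exists c' : cell S,
      [&& T c == v, T c' == v.+1 :> nat & (cell_row c < cell_row c')%N]]]|.

(** * The chain algebra and its Hilbert function *)

Section ChainAlgebra.
Variables (K : fieldType) (dL : Order.disp_t) (L : finTBDistrLatticeType dL).

Definition is_chain (C : {set L}) : bool :=
  [forall x in C, forall y in C, (x >=< y)%O].

Definition max_chains : {set {set L}} := [set C | maxset is_chain C].

(* The element x of L is the variable of K[L] with index [enum_rank x]. *)
Definition chain_monomial (C : {set L}) : {mpoly K[#|L|]} :=
  \prod_(x in C) 'X_(enum_rank x).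

Definition chain_generators : #|max_chains|.-tuple {mpoly K[#|L|]} :=
  [tuple chain_monomial (enum_val i) | i < #|max_chains|].

(* The K-subalgebra of K[L] generated by the t_C is the set of all values
   F(t_C : C) of polynomials F over K. *)
Definition chain_algebra (f : {mpoly K[#|L|]}) : Prop :=
  exists F : {mpoly K[#|max_chains|]}, f = F \mPo chain_generators.

(* For deg t_C = 1, the component of degree k consists of the values of the
   forms F of degree k, i.e. it is the K-span of the products of k generators.  These
   components are in direct sum because all t_C have the same degree in K[L]. *)
Definition chain_algebra_component (k : nat) (f : {mpoly K[#|L|]}) : Prop :=
  exists2 F : {mpoly K[#|max_chains|]},
    F \is k.-homog & f = F \mPo chain_generators.

Lemma chain_algebra_sum_components (f : {mpoly K[#|L|]}) :
  chain_algebra f <->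
  exists n (g : 'I_n -> {mpoly K[#|L|]}),
    (forall i : 'I_n, chain_algebra_component i (g i)) /\ f = \sum_i g i.
Proof.
split=> [[F ->]|[n [g [gP ->]]]].
  exists (msize F), (fun i => pihomog mdeg i F \mPo chain_generators); split.
    by move=> i; exists (pihomog mdeg i F) => //; apply: pihomogP.
  by rewrite -[in RHS]raddf_sum /= -pihomog_partitionE.
suff [G GE] : exists G : 'I_n -> {mpoly K[#|max_chains|]},
    forall i, g i = G i \mPo chain_generators.
  by exists (\sum_i G i); rewrite raddf_sum; apply: eq_bigr => i _; apply: GE.
have {}gP (i : 'I_n) : chain_algebra (g i) by have [G _ GE] := gP i; exists G.
elim: n g gP => [|n IH] g gP; first by exists (fun=> 0) => -[].
have [F FE] := gP ord_max.
have [|G GE] := IH (fun i => g (widen_ord (leqnSn n) i)); first by move=> i.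
exists (fun i => if unlift ord_max i is Some j then G j else F) => i.
case: unliftP => [j ->|-> //]; rewrite -GE; congr g.
by apply: val_inj; rewrite /= /bump leqNgt ltn_ord.
Qed.

End ChainAlgebra.

(* The subspace W of V has a basis with n elements. *)
Definition has_dim (K : fieldType) (V : lmodType K) (W : V -> Prop) (n : nat) : Prop :=
  exists e : 'I_n -> V,
    [/\ forall i, W (e i),
        forall c : 'I_n -> K, \sum_i c i *: e i = 0 -> forall i, c i = 0
      & forall v, W v -> exists c : 'I_n -> K, v = \sum_i c i *: e i].

(* H k is the K-dimension of the component of degree k of K[C_L]. *)
Definition chain_hilbert_function (K : fieldType) (dL : Order.disp_t)
    (L : finTBDistrLatticeType dL) (H : nat -> nat) : Prop :=
  forall k, has_dim (@chain_algebra_component K dL L k) (H k).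

(* The formal power series \sum_k (H k) z^k equals N / D, that is, its Cauchy
   product with D is N.  Meant for D with constant coefficient 1, which is
   invertible as a power series. *)
Definition power_series_eq_frac (H : nat -> nat) (N D : {poly int}) : Prop :=
  forall k : nat, \sum_(i < k.+1) (H i)%:Z * D`_(k - i) = N`_k.

(* Main.v *)
Require Import Defs.
From mathcomp Require Import all_boot all_order all_algebra.
From mathcomp Require Import mpoly zify.

(** Monomials in the [t_C] of degree [k] are products of [k] maximal chains, so
    the Hilbert function at [k] counts the distinct such products
    ([monomial_component_dim]).

    In the coordinates of an ideal, a maximal chain is a lattice path, and it is
    recorded by the set [U] of cells to its lower right.  This set is closed
    under moving right and down, and every set with this closure comes from
    exactly one maximal chain ([max_chain_boundary], [boundary_max_chain]).
    Whether a lattice point lies on the path can be read off the two cells that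
    touch it at its lower right and at its upper left: the first must lie in
    [U] and the second must not.  Since the second lies in [U] only if the first
    does, the indicator of the path at the point is the difference of the
    indicators of [U] at the two cells.  This is linear, so the exponent of a
    product of [k] chains depends only on the sum [s] of the indicators of the
    corresponding sets [U] ([boundary_sum]), and it determines [s]
    ([boundary_sum_inj]).  The functions [s] that occur are exactly the order
    preserving maps from the cells to {0, ..., k}, because such a map is the sum
    of the indicators of its [k] superlevel sets.  Hence the Hilbert function is
    the order polynomial of the poset of cells ([chain_component_dim]).

    The rest is Stanley's theory of P-partitions.  An order preserving map is
    sorted into a linear extension [T] by value, ties being broken by the reading
    order of the cells (top row first, rows from left to right).  The maps sorted
    into [T] are the weakly increasing sequences in {0, ..., k} that increase
    strictly at the descents of [T], and there are as many of them as there are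
    [d]-subsets of a set with [k + d - des T] elements ([card_order_maps]).
    Summing over [k] gives z ^ (des T) / (1 - z) ^ (d + 1)
    ([binomial_series_frac]).  For the reading order, the linear extensions are
    the standard tableaux and their descents are the ascents of the tableaux
    ([is_SYT_linear_extension], [asc_descents]). *)

Set Implicit Arguments.
Unset Strict Implicit.
Unset Printing Implicit Defensive.

Import Order.TTheory GRing.Theory Num.Theory.

(** * Ranks in a finite totally ordered family *)

Lemma card_ord_lt (d v : nat) : (v <= d)%N -> #|[set w : 'I_d | (w < v)%N]| = v.
Proof.
by move=> le_vd; rewrite -sum1dep_card (big_ord_narrow le_vd) sum1_card card_ord.
Qed.

Section Rank.
Variables (dO : Order.disp_t) (O : orderType dO) (Q : finType) (d : nat).
Hypothesis cardQ : #|Q| = d.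

Lemma rank_subproof (key : Q -> O) (c : Q) :
  (#|[set c' | (key c' < key c)%O]| < d)%N.
Proof.
rewrite -cardQ -cardsT; apply: proper_card; apply/properP.
by split; [apply: subsetT | exists c; rewrite ?inE ?ltxx].
Qed.

Definition rank (key : Q -> O) : {ffun Q -> 'I_d} :=
  [ffun c => Ordinal (rank_subproof key c)].

Lemma rank_lt (key : Q -> O) (c c' : Q) :
  (rank key c < rank key c')%N = (key c < key c')%O.
Proof.
rewrite !ffunE /=; case: (ltP (key c) (key c')) => [lt_cc'|le_c'c].
  apply: proper_card; apply/properP; split.
    by apply/subsetP=> e; rewrite !inE => /lt_trans; apply.
  by exists c; rewrite !inE ?ltxx.
apply/negbTE; rewrite -leqNgt subset_leq_card //.
by apply/subsetP=> e; rewrite !inE => /lt_le_trans; apply.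
Qed.

Lemma rank_inj (key : Q -> O) : injective key -> injective (rank key).
Proof.
move=> key_inj c c' eq_r; apply: key_inj; apply/eqP.
by rewrite eq_le !leNgt -!rank_lt eq_r ltnn.
Qed.

(** Pulling the values of [T] back shows that the elements below [c] for the key
    are those below [c] for [T], and the latter are counted by [T c]. *)
Lemma rank_unique (key : Q -> O) (T : {ffun Q -> 'I_d}) :
  injective T -> (forall c c', (T c < T c')%N -> (key c < key c')%O) ->
  rank key = T.
Proof.
move=> T_inj T_key; apply/ffunP=> c; apply/val_inj; rewrite ffunE /=.
have key_T c1 c2 : (key c1 < key c2)%O = (T c1 < T c2)%N.
  apply/idP/idP=> [lt_key|]; last exact: T_key.
  case: ltngtP => // [/T_key lt_key'|/val_inj/T_inj eq_c].
    by have := lt_trans lt_key lt_key'; rewrite ltxx.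
  by rewrite eq_c ltxx in lt_key.
rewrite -(card_imset _ T_inj) -[RHS](card_ord_lt (ltnW (ltn_ord _))).
have T_bij : bijective T by apply: inj_card_bij T_inj _; rewrite card_ord cardQ.
case: T_bij => g gT Tg; apply: eq_card => v.
apply/imsetP/idP => [[c' + ->]|]; rewrite !inE ?key_T //.
by exists (g v); rewrite ?inE ?key_T Tg.
Qed.

End Rank.

Lemma ltn_ord_homo (d : nat) (R : rel 'I_d) : transitive R ->
  (forall v w : 'I_d, w = v.+1 :> nat -> R v w) ->
  forall v w : 'I_d, (v < w)%N -> R v w.
Proof.
move=> R_tr R_step v w; case: w => w; elim: w => // w IH ltwd.
rewrite /= ltnS leq_eqVlt => /predU1P[eq_vw | lt_vw].
  by apply: R_step; rewrite /= eq_vw.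
apply: (R_tr (Ordinal (ltnW ltwd))); first exact: IH.
exact: R_step.
Qed.

(** * Order preserving maps and linear extensions *)

Section PPartitions.
(* [lt] is a set of order constraints, such as the generating relations of a
   strict order, and [om] is a natural labelling for it. *)
Variables (Q : finType) (d : nat) (lt : rel Q) (om : Q -> nat).
Hypotheses (cardQ : #|Q| = d) (om_inj : injective om).
Hypothesis om_lt : forall c c', lt c c' -> (om c < om c')%N.

Definition order_maps (k : nat) : {set {ffun Q -> 'I_k.+1}} :=
  [set s : {ffun Q -> 'I_k.+1} | [forall c, forall c', lt c c' ==> (s c <= s c')%N]].

Definition linear_extension (T : {ffun Q -> 'I_d}) : bool :=
  injectiveb T && [forall c, forall c', lt c c' ==> (T c < T c')%N].

Definition descents (T : {ffun Q -> 'I_d}) : {set 'I_d} :=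
  [set v : 'I_d | [exists c, exists c',
     [&& T c == v, T c' == v.+1 :> nat & (om c' < om c)%N]]].

(** The sorting key of a map: its value first, then the label, which breaks ties. *)
Definition lex_key (k : nat) (s : {ffun Q -> 'I_k.+1}) (c : Q) : (nat *l nat)%type :=
  ((s c : nat), om c).

Lemma lex_keyE k (s : {ffun Q -> 'I_k.+1}) c c' :
  (lex_key s c < lex_key s c')%O =
  (s c < s c')%N || ((s c == s c') && (om c < om c')%N).
Proof.
rewrite /lex_key ltEprodlexi /= !leEnat ltEnat /= -val_eqE.
by rewrite /=; case: (ltngtP (s c) (s c')) => _.
Qed.

Lemma lex_key_inj k (s : {ffun Q -> 'I_k.+1}) : injective (lex_key s).
Proof. by move=> c c' [_ /om_inj]. Qed.

(** The maps compatible with [T] are those which sorting turns into [T]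
    ([order_maps_rank]). *)
Definition compatible k (T : {ffun Q -> 'I_d}) (s : {ffun Q -> 'I_k.+1}) : bool :=
  [forall c, forall c', (T c < T c')%N ==> (lex_key s c < lex_key s c')%O].

Lemma compatibleP k (T : {ffun Q -> 'I_d}) (s : {ffun Q -> 'I_k.+1}) :
  reflect (forall c c', (T c < T c')%N -> (lex_key s c < lex_key s c')%O)
          (compatible T s).
Proof.
apply: (iffP forallP) => [h c c'|h c]; first by move/forallP/(_ c')/implyP: (h c).
by apply/forallP => c'; apply/implyP/h.
Qed.

(** Two elements with a constraint between them and equal values are sorted by
    their labels, which is the right order because the labelling is natural. *)
Lemma rank_linear_extension k (s : {ffun Q -> 'I_k.+1}) :
  s \in order_maps k -> linear_extension (rank cardQ (lex_key s)).
Proof.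
rewrite inE => /forallP s_mono; apply/andP; split.
  by apply/injectiveP/rank_inj/lex_key_inj.
apply/forallP=> c; apply/forallP=> c'; apply/implyP=> lt_cc'.
have /forallP/(_ c')/implyP/(_ lt_cc') := s_mono c.
rewrite rank_lt lex_keyE leq_eqVlt => /orP[/eqP eq_s|-> //].
by rewrite -val_eqE /= eq_s eqxx om_lt // orbT.
Qed.

Lemma order_maps_rank k (T : {ffun Q -> 'I_d}) (s : {ffun Q -> 'I_k.+1}) :
  linear_extension T ->
  (s \in order_maps k) && (rank cardQ (lex_key s) == T) = compatible T s.
Proof.
case/andP=> /injectiveP T_inj /forallP T_mono; apply/andP/idP.
  case=> _ /eqP <-; apply/compatibleP=> c c'.
  by rewrite rank_lt.
move/compatibleP=> T_s; split; last by rewrite (rank_unique cardQ T_inj T_s).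
rewrite inE; apply/forallP=> c; apply/forallP=> c'; apply/implyP=> lt_cc'.
have /forallP/(_ c')/implyP/(_ lt_cc') := T_mono c.
by move/T_s; rewrite lex_keyE => /orP[/ltnW|/andP[/eqP -> _]].
Qed.

Section Compatible.
Variables (k : nat) (T : {ffun Q -> 'I_d}) (g : 'I_d -> Q).
Hypotheses (gT : cancel T g) (Tg : cancel g T).

(* [ndes v] counts the positions before [v] at which equality of consecutive
   values is allowed. *)
Let ndes (v : nat) : nat := #|[set w : 'I_d | (w < v)%N && (w \notin descents T)]|.

Lemma descentsE (v w : 'I_d) : w = v.+1 :> nat ->
  (v \in descents T) = (om (g w) < om (g v))%N.
Proof.
move=> eq_w; rewrite inE; apply/existsP/idP => [[c /existsP[c']]|lt_om].
  rewrite -eq_w val_eqE => /and3P[/eqP <- /eqP <-].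
  by rewrite !gT.
exists (g v); apply/existsP; exists (g w); rewrite !Tg eq_w !eqxx.
by rewrite lt_om.
Qed.

Lemma ndes_step (v : 'I_d) : ndes v.+1 = (ndes v + (v \notin descents T))%N.
Proof.
rewrite /ndes (cardsD1 v) in_set ltnSn addnC /=; congr (_ + _)%N.
apply: eq_card => w; rewrite in_setD1 !in_set ltnS -val_eqE /=.
by rewrite (ltn_neqAle w v) andbA.
Qed.

Lemma ndes_le (v : 'I_d) : (v <= ndes v + #|descents T|)%N.
Proof.
rewrite -[X in (X <= _)%N](card_ord_lt (ltnW (ltn_ord v))) /ndes.
apply: leq_trans (leq_card_setU _ _); apply/subset_leq_card/subsetP=> w.
by rewrite !inE => ->; case: [exists _, _].
Qed.

Lemma ndes_ub (v : 'I_d) : (ndes v <= v)%N.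
Proof.
rewrite -[X in (_ <= X)%N](card_ord_lt (ltnW (ltn_ord v))).
by apply/subset_leq_card/subsetP => w; rewrite !inE => /andP[].
Qed.

(** The strict inequality holds because the last position, which has no successor,
    is not a descent. *)
Lemma ndes_descents (v : 'I_d) : (ndes v + #|descents T| < d)%N.
Proof.
have d_gt0 : (0 < d)%N by apply: leq_ltn_trans (ltn_ord v).
have lastP : (d.-1 < d)%N by rewrite prednK.
pose last := Ordinal lastP; pose A := [set w : 'I_d | (w < v)%N && (w \notin descents T)].
have disj : A :&: descents T = set0.
  by apply/setP=> w; rewrite !inE -andbA; case: [exists _, _]; rewrite ?andbF.
have -> : (ndes v + #|descents T| = #|A :|: descents T|)%N.
  by rewrite cardsU disj cards0 subn0.
rewrite -[X in (_ < X)%N](card_ord d) -cardsT; apply/proper_card/properP.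
split; first exact: subsetT.
exists last => //; rewrite !inE negb_or; apply/andP; split.
  by apply/nandP; left; rewrite /= -leqNgt -ltnS prednK.
apply/negP=> /existsP[c /existsP[c' /and3P[_ /eqP + _]]] /=.
by move=> eq_T; have := ltn_ord (T c'); rewrite eq_T /= prednK // ltnn.
Qed.

Let N := (k + d - #|descents T|)%N.

(* Adding [ndes] turns every weak inequality between consecutive values into a
   strict one, so that compatible maps become strictly increasing sequences. *)
Let spread (s : {ffun Q -> 'I_k.+1}) (v : 'I_d) : nat := (s (g v) + ndes v)%N.

Lemma spread_step (s : {ffun Q -> 'I_k.+1}) (v w : 'I_d) : w = v.+1 :> nat ->
  (lex_key s (g v) < lex_key s (g w))%O = (spread s v < spread s w)%N.
Proof.
move=> eq_w; rewrite lex_keyE /spread eq_w ndes_step (descentsE eq_w) -leqNgt -val_eqE /=.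
have neq_om : om (g v) != om (g w).
  rewrite (inj_eq om_inj) (can_eq Tg) -val_eqE /= eq_w; lia.
by move: neq_om; case: (ltngtP (om (g v))) => //=; lia.
Qed.

(** Both orders being total, it suffices to compare consecutive positions. *)
Lemma compatible_spread (s : {ffun Q -> 'I_k.+1}) :
  compatible T s = [forall v : 'I_d, forall w : 'I_d, (v < w)%N ==> (spread s v < spread s w)%N].
Proof.
apply/compatibleP/forallP=> [T_s v|s_mono c c' lt_cc'].
  apply/forallP=> w; apply/implyP; move: v w.
  apply: ltn_ord_homo => [v1 v2 v3|v w eq_w]; first exact: ltn_trans.
  by rewrite -spread_step //; apply: T_s; rewrite !Tg eq_w.
rewrite -[c]gT -[c']gT; move: (T c) (T c') lt_cc'.
apply: ltn_ord_homo => [v1 v2 v3|v w eq_w]; first exact: lt_trans.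
rewrite spread_step //; have /forallP/(_ w)/implyP := s_mono v; apply.
by rewrite eq_w.
Qed.

Lemma spread_bound (s : {ffun Q -> 'I_k.+1}) (v : 'I_d) : (spread s v < N)%N.
Proof.
rewrite /spread /N; have := ltn_ord (s (g v)); have := ndes_descents v; lia.
Qed.

Let unspread (u : d.-tuple 'I_N) : {ffun Q -> 'I_k.+1} :=
  [ffun c => inord (tnth u (T c) - ndes (T c))].

Lemma sorted_tupleP (u : d.-tuple 'I_N) :
  reflect (forall v w : 'I_d, (v < w)%N -> (tnth u v < tnth u w)%N)
          (sorted ltn (map val u)).
Proof.
have nthE (v : 'I_d) : nth 0%N (map val u) v = tnth u v.
  exact: etrans (esym (tnth_nth 0%N (map_tuple val u) v)) (tnth_map val u v).
apply: (iffP idP) => [u_sorted v w lt_vw|u_mono].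
  rewrite -!nthE; apply: (sorted_ltn_nth ltn_trans) => //.
    by rewrite inE size_map size_tuple.
  by rewrite inE size_map size_tuple.
apply/(sortedP 0%N) => i; rewrite size_map size_tuple => lt_i.
by rewrite (nthE (Ordinal (ltnW lt_i))) (nthE (Ordinal lt_i)); apply: u_mono.
Qed.

Lemma sorted_tuple_lb (u : d.-tuple 'I_N) : sorted ltn (map val u) ->
  forall v : 'I_d, (v <= tnth u v)%N.
Proof.
move/sorted_tupleP=> u_mono [v]; elim: v => //= v IH ltvd.
apply: leq_ltn_trans (IH (ltnW ltvd)) _; exact: u_mono.
Qed.

Lemma sorted_tuple_ub (u : d.-tuple 'I_N) : sorted ltn (map val u) ->
  forall v : 'I_d, (tnth u v + d <= N + v)%N.
Proof.
move/sorted_tupleP=> u_mono v.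
suff ub m : forall w : 'I_d, (w + m.+1 = d)%N -> (tnth u w + d <= N + w)%N.
  by apply: (ub (d - v.+1)%N); have := ltn_ord v; lia.
elim: m => [|m IH] w eq_d; first by have := ltn_ord (tnth u w); lia.
have ltwd : (w.+1 < d)%N by lia.
have := IH (Ordinal ltwd); have /= := u_mono w (Ordinal ltwd); lia.
Qed.

Lemma unspreadE (u : d.-tuple 'I_N) (v : 'I_d) : sorted ltn (map val u) ->
  spread (unspread u) v = tnth u v.
Proof.
move=> u_sorted; have := sorted_tuple_lb u_sorted v.
have := sorted_tuple_ub u_sorted v.
have := ndes_le v; have := ndes_ub v; have := ndes_descents v.
rewrite /spread ffunE Tg /N => *; rewrite inordK; lia.
Qed.

(** [unspread] is a bijection from the strictly increasing sequences in
    {0, ..., N - 1} onto the compatible maps.  It is used in this direction since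
    the type of sequences may be empty, while maps to {0, ..., k} always have a
    default value. *)
Lemma card_compatible : #|[set s : {ffun Q -> 'I_k.+1} | compatible T s]| = 'C(N, d).
Proof.
rewrite -card_ltn_sorted_tuples -(card_in_imset (f := unspread)); last first.
  move=> u u'; rewrite !inE => u_s u'_s eq_u; apply: eq_from_tnth => v.
  by apply: val_inj; rewrite /= -!unspreadE // eq_u.
apply: eq_card => s; rewrite inE compatible_spread; apply/forallP/imsetP.
  move=> s_mono; pose u := [tuple Ordinal (spread_bound s v) | v < d].
  have u_sorted : sorted ltn (map val u).
    apply/sorted_tupleP=> v w lt_vw; rewrite !tnth_mktuple /=.
    by have /forallP/(_ w)/implyP := s_mono v; apply.
  exists u; first by rewrite inE.
  apply/ffunP=> c; apply: val_inj; have := unspreadE (T c) u_sorted.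
  by rewrite tnth_mktuple /spread /= gT => /addIn.
case=> u; rewrite inE => u_sorted -> v; apply/forallP=> w; apply/implyP.
by rewrite !unspreadE //; apply/sorted_tupleP.
Qed.

End Compatible.

(** Every order preserving map is compatible with exactly one linear extension,
    the one obtained by sorting. *)
Theorem card_order_maps k :
  #|order_maps k| = \sum_(T | linear_extension T) 'C(k + d - #|descents T|, d).
Proof.
rewrite -sum1_card (partition_big (fun s => rank cardQ (lex_key s)) linear_extension);
  last exact: rank_linear_extension.
apply: eq_bigr => T T_lin.
have /andP[/injectiveP T_inj _] := T_lin.
have [g gT Tg] : bijective T by apply: inj_card_bij T_inj _; rewrite card_ord cardQ.
rewrite -(card_compatible k gT Tg) -sum1dep_card; apply: eq_bigl => s.
exact: order_maps_rank.
Qed.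

End PPartitions.
(** * Generating functions of binomial coefficients *)

Local Open Scope ring_scope.

(** Multiplying by [1 - 'X] replaces a sequence by its differences, and Pascal's
    rule says that the differences of C(i + d + 1, d + 1) are C(i + d, d). *)
Lemma binomial_series_inverse (d k : nat) :
  \sum_(i < k.+1) 'C(i + d, d)%:Z * ((1 - 'X) ^+ d.+1)`_(k - i) = (k == 0%N)%:Z.
Proof.
elim: d k => [|d IH] k.
  rewrite expr1; case: k => [|k].
    by rewrite big_ord1 subn0 coefB coef1 coefX.
  rewrite big_ord_recr big_ord_recr big1 /= => [|i _].
    by rewrite subnn subSnn !coefB !coef1 !coefX !bin0.
  by rewrite coefB coef1 coefX; have := ltn_ord i; case: eqP; case: eqP; lia.
rewrite exprS -[RHS](IH k); set D := (1 - 'X) ^+ d.+1.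
have coefD j : ((1 - 'X) * D)`_j = D`_j - (if j is j'.+1 then D`_j' else 0).
  by rewrite mulrBl mul1r coefB coefXM; case: j.
under eq_bigr do rewrite coefD mulrBr.
rewrite sumrB [X in _ - X]big_ord_recr /= subnn mulr0 addr0.
rewrite [X in X - _]big_ord_recl [RHS]big_ord_recl /=.
rewrite !add0n !binn -addrA; congr (_ + _).
rewrite -sumrB; apply: eq_bigr => i _; rewrite /bump /= add1n.
rewrite -(subnSK (ltn_ord i)) -mulrBl; congr (_ * _).
by rewrite addSn addnS addSn binS PoszD; lia.
Qed.

(** The previous series shifted by [s]: for [i < s] the binomial coefficient
    vanishes, and [s <= d] keeps the truncated subtraction exact. *)
Lemma binomial_series_frac (d s k : nat) : (s <= d)%N ->
  \sum_(i < k.+1) 'C(i + d - s, d)%:Z * ((1 - 'X) ^+ d.+1)`_(k - i) = (k == s)%:Z.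
Proof.
move=> le_sd; rewrite -(big_mkord xpredT
  (fun i => 'C(i + d - s, d)%:Z * ((1 - 'X) ^+ d.+1)`_(k - i))).
case: (leqP s k) => [le_sk|lt_ks]; last first.
  rewrite big_nat big1 => [|i lt_i]; first by case: eqP => //; lia.
  by rewrite bin_small ?mul0r //; lia.
rewrite (big_cat_nat (n := s)) ?leqW //= big_nat big1 ?add0r => [|i lt_i]; last first.
  by rewrite bin_small ?mul0r //; lia.
rewrite -[s in LHS]add0n big_addn big_mkord subSn //.
rewrite (eqn_leq k) le_sk andbT -subn_eq0 -(binomial_series_inverse d (k - s)).
apply: eq_bigr => i _; congr (_%:Z * _`_ _); last by lia.
by congr ('C(_, _)); lia.
Qed.

(** * Graded components of monomial subalgebras *)

(** A homogeneous component of a subalgebra generated by monomials is spanned by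
    monomials, so its dimension is the number of distinct exponents; [B]
    enumerates them. *)
Lemma monomial_component_dim (K : fieldType) (n N k D : nat)
    (g : N.-tuple {mpoly K[n]}) (w : 'I_N -> 'X_{1..n}) (B : 'I_D -> 'X_{1..n}) :
  (forall i, tnth g i = 'X_[w i]) -> injective B ->
  (forall j, exists2 F, F \is k.-homog & 'X_[B j] = F \mPo g) ->
  (forall m : 'X_{1..N}, mdeg m = k -> exists j, (\sum_i w i *+ m i)%MM = B j) ->
  has_dim (fun f : {mpoly K[n]} => exists2 F : {mpoly K[N]}, F \is k.-homog & f = F \mPo g) D.
Proof.
move=> gE B_inj B_in B_onto; exists (fun j => 'X_[B j]); split=> // [c c0 j|v [F F_homog ->]].
  have := congr1 (fun p : {mpoly K[n]} => p@_(B j)) c0.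
  rewrite mcoeff0 raddf_sum /= (bigD1 j) //= mcoeffZ mcoeffX eqxx mulr1.
  rewrite big1 ?addr0 // => i ne_ij; rewrite mcoeffZ mcoeffX.
  by rewrite (inj_eq B_inj) (negbTE ne_ij) mulr0.
(* The coordinates of an element are its own coefficients; what has to be checked
   is that all other coefficients vanish. *)
exists (fun j => (F \mPo g)@_(B j)); apply/mpolyP=> m.
rewrite [RHS]raddf_sum /=; under [RHS]eq_bigr do rewrite mcoeffZ mcoeffX.
have [/existsP[j /eqP <-]|noB] := boolP [exists j, B j == m].
  rewrite (bigD1 j) //= eqxx mulr1 big1 ?addr0 // => i ne_ij.
  by rewrite (inj_eq B_inj) (negbTE ne_ij) mulr0.
rewrite big1 => [|j _]; last first.
  by move: noB; rewrite negb_exists => /forallP/(_ j)/negbTE ->; rewrite mulr0.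
rewrite comp_mpolyEX raddf_sum big_seq big1 //= => m' m'F; rewrite mcoeffZ.
have [j defB] := B_onto _ (dhomog_mf F_homog m'F).
rewrite comp_mpolyX; under eq_bigr do rewrite gE.
rewrite mprodXnE defB mcoeffX.
by move: noB; rewrite negb_exists => /forallP/(_ j)/negbTE ->; rewrite mulr0.
Qed.

Definition chain_exponent (dL : Order.disp_t) (L : finTBDistrLatticeType dL)
    (C : {set L}) : 'X_{1..#|L|} :=
  [multinom (enum_val y \in C : nat) | y < #|L|].

Lemma chain_monomialE (K : fieldType) (dL : Order.disp_t)
    (L : finTBDistrLatticeType dL) (C : {set L}) :
  chain_monomial K C = 'X_[chain_exponent C].
Proof.
rewrite /chain_monomial mprodXE; congr 'X_[_]; apply/mnmP=> y.
rewrite mnm_sumE mnmE; under eq_bigr do rewrite mnm1E.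
have [yC|yNC] := boolP (enum_val y \in C).
  rewrite (bigD1 (enum_val y)) //= enum_valK eqxx big1 // => x /andP[_ ne_x].
  by rewrite -[y]enum_valK (inj_eq enum_rank_inj) (negbTE ne_x).
rewrite big1 // => x xC; case: eqP => // eq_y.
by rewrite -eq_y enum_rankK xC in yNC.
Qed.

(** * Maximal chains and filters of cells *)

(** Smaller cells are those further to the left in the same row and further up in
    the same column.  Only these generating relations are recorded: they are the
    constraints that define tableaux, and [up_closed_dominates] recovers the
    componentwise order from them. *)
Definition cell_lt (a b : nat) (S : {set 'I_b * 'I_a}) (c c' : cell S) : bool :=
  ((cell_row c == cell_row c') && (cell_col c < cell_col c')%N)
  || ((cell_col c == cell_col c') && (cell_row c' < cell_row c)%N).

Section ChainsAndFilters.
Variables (dL : Order.disp_t) (L : finTBDistrLatticeType dL) (a b : nat).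
(* [L] is seen as the set of lattice points (X, Y) of the region between the two
   extreme paths, and [mu i], [lam i] bound the abscissas at which a path may
   climb through row [i]. *)
Variables (X Y : L -> nat) (mu lam : 'I_b -> nat) (S : {set 'I_b * 'I_a}).
Hypothesis leXY : forall x y, (x <= y)%O = (X x <= X y)%N && (Y x <= Y y)%N.
Hypothesis Y_le : forall x, (Y x <= b)%N.
Hypothesis mu_le_X : forall x (i : 'I_b), (i < Y x)%N -> (mu i <= X x)%N.
Hypothesis X_le_lam : forall x (i : 'I_b), (Y x <= i)%N -> (X x <= lam i)%N.
Hypothesis XY_onto : forall p q, (p <= a)%N -> (q <= b)%N ->
  (forall i : 'I_b, (i < q)%N -> (mu i <= p)%N) ->
  (forall i : 'I_b, (q <= i)%N -> (p <= lam i)%N) -> exists2 x, X x = p & Y x = q.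
Hypothesis mu_mono : forall i j : 'I_b, (i <= j)%N -> (mu i <= mu j)%N.
Hypothesis lam_mono : forall i j : 'I_b, (i <= j)%N -> (lam i <= lam j)%N.
Hypothesis lam_le : forall i, (lam i <= a)%N.
Hypothesis in_S : forall i j, ((i, j) \in S) = (mu i <= j < lam i)%N.

Local Notation row := cell_row.
Local Notation col := cell_col.
Implicit Types (x y : L) (c : cell S) (U : {set cell S}) (C : {set L}).

Lemma cell_bounds c : (mu (row c) <= col c < lam (row c))%N.
Proof. by rewrite -in_S -surjective_pairing (valP c). Qed.

Lemma cell_eq c c' : row c = row c' :> nat -> col c = col c' :> nat -> c = c'.
Proof.
move=> /val_inj eq_r /val_inj eq_c; apply: val_inj.
by rewrite (surjective_pairing (val c)) (surjective_pairing (val c')); congr (_, _).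
Qed.

Lemma cell_exists (i : 'I_b) (j : nat) : (mu i <= j < lam i)%N ->
  exists2 c : cell S, row c = i & col c = j :> nat.
Proof.
move=> /[dup] ij_in /andP[_ /leq_trans/(_ (lam_le i)) lt_ja].
have ijS : (i, Ordinal lt_ja) \in S by rewrite in_S.
by exists (exist (fun ij => ij \in S) _ ijS).
Qed.

Definition up_closed U := forall c c', c \in U -> cell_lt c c' -> c' \in U.

(** The corner (row c', col c) of the rectangle spanned by the two cells lies in
    the skew shape, because [mu] and [lam] are monotone; one goes through it. *)
Lemma up_closed_dominates U c c' : up_closed U -> c \in U ->
  (row c' <= row c)%N -> (col c <= col c')%N -> c' \in U.
Proof.
move=> U_up cU le_r le_c.
have /andP[mu_c _] := cell_bounds c; have /andP[_ lam_c'] := cell_bounds c'.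
have [|c1 row_c1 col_c1] := @cell_exists (row c') (col c).
  by rewrite (leq_trans (mu_mono le_r)) //= (leq_ltn_trans le_c).
have c1U : c1 \in U.
  move: le_r; rewrite leq_eqVlt => /predU1P[eq_r|lt_r].
    by rewrite (@cell_eq c1 c) // row_c1.
  apply: (U_up _ _ cU); rewrite /cell_lt orbC -val_eqE /= col_c1 eqxx.
  by rewrite row_c1 lt_r.
move: le_c; rewrite leq_eqVlt => /predU1P[eq_c|lt_c].
  by rewrite (@cell_eq c' c1) // ?row_c1 // col_c1.
by apply: (U_up _ _ c1U); rewrite /cell_lt row_c1 eqxx /= col_c1 lt_c.
Qed.

(** The cell whose upper left corner is the point [x]; it is absent if the region
    does not extend to the lower right of [x].  Likewise, [nw_cell x] is the cell
    whose lower right corner is [x]. *)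
Definition se_cell x : option (cell S) :=
  [pick c | ((row c).+1 == Y x) && (col c == X x :> nat)].
Definition nw_cell x : option (cell S) :=
  [pick c | (row c == Y x :> nat) && ((col c).+1 == X x)].

Lemma se_cellE x c : (row c).+1 = Y x -> col c = X x :> nat -> se_cell x = Some c.
Proof.
move=> rowE colE; rewrite /se_cell; case: pickP => [c' /andP[/eqP r /eqP e]|/(_ c)].
  by congr Some; apply: cell_eq; [apply: succn_inj; rewrite r|rewrite e].
by rewrite rowE colE !eqxx.
Qed.

Lemma nw_cellE x c : row c = Y x :> nat -> (col c).+1 = X x -> nw_cell x = Some c.
Proof.
move=> rowE colE; rewrite /nw_cell; case: pickP => [c' /andP[/eqP r /eqP e]|/(_ c)].
  by congr Some; apply: cell_eq; [rewrite r|apply: succn_inj; rewrite e].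
by rewrite rowE colE !eqxx.
Qed.

Lemma se_cellP x c : se_cell x = Some c -> (row c).+1 = Y x /\ col c = X x :> nat.
Proof. by rewrite /se_cell; case: pickP => // c' /andP[/eqP ? /eqP ?] [<-]. Qed.

Lemma nw_cellP x c : nw_cell x = Some c -> row c = Y x :> nat /\ (col c).+1 = X x.
Proof. by rewrite /nw_cell; case: pickP => // c' /andP[/eqP ? /eqP ?] [<-]. Qed.

(* The defaults are the values for an empty quadrant, which is contained in [U]
   and does not meet it. *)
Definition below_in U x : bool := oapp (fun c => c \in U) true (se_cell x).
Definition above_meets U x : bool := oapp (fun c => c \in U) false (nw_cell x).

(** [se_cell x] is the least cell of the lower right quadrant at [x], so for an
    upward closed [U] it decides whether the whole quadrant lies in [U]. *)
Lemma below_inP U x : up_closed U ->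
  reflect (forall c, (row c < Y x)%N -> (X x <= col c)%N -> c \in U) (below_in U x).
Proof.
move=> U_up; apply: (iffP idP) => [seU c lt_cY le_Xc|inU]; last first.
  rewrite /below_in; case def_c: (se_cell x) => [c|] //=.
  by have [rowE colE] := se_cellP def_c; apply: inU; rewrite -?rowE ?colE.
have [i defY] : exists i : 'I_b, i.+1 = Y x.
  have Y_gt0 : (0 < Y x)%N by apply: leq_ltn_trans lt_cY.
  have lt_Yb : ((Y x).-1 < b)%N by rewrite prednK ?Y_le.
  by exists (Ordinal lt_Yb); rewrite /= prednK.
have le_ci : (row c <= i)%N by rewrite -ltnS defY.
have /andP[_ lt_c] := cell_bounds c.
have [|c0 row_c0 col_c0] := @cell_exists i (X x).
  rewrite mu_le_X -?defY //=; apply: leq_ltn_trans le_Xc _.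
  exact: leq_trans lt_c (lam_mono le_ci).
have def_se : se_cell x = Some c0 by apply: se_cellE; rewrite ?row_c0.
move: seU; rewrite /below_in def_se /= => /(up_closed_dominates U_up); apply.
  by rewrite row_c0.
by rewrite col_c0.
Qed.

(** Dually, [nw_cell x] is the greatest cell of the upper left quadrant at [x]. *)
Lemma above_meetsP U x : up_closed U ->
  reflect (exists c, [/\ c \in U, (Y x <= row c)%N & (col c < X x)%N]) (above_meets U x).
Proof.
move=> U_up; apply: (iffP idP) => [|[c [cU le_Yc lt_cX]]].
  rewrite /above_meets; case def_c: (nw_cell x) => [c|] //= cU.
  by have [rowE colE] := nw_cellP def_c; exists c; rewrite rowE -colE.
have lt_Yb : (Y x < b)%N by apply: leq_ltn_trans (ltn_ord (row c)).
pose i := Ordinal lt_Yb; have /andP[mu_c _] := cell_bounds c.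
have X_gt0 : (0 < X x)%N by apply: leq_ltn_trans lt_cX.
have [|c0 row_c0 col_c0] := @cell_exists i (X x).-1.
  rewrite prednK // X_le_lam // andbT -ltnS prednK //.
  by apply: leq_ltn_trans lt_cX; apply: leq_trans mu_c; apply: mu_mono.
have def_nw : nw_cell x = Some c0.
  by apply: nw_cellE; rewrite ?row_c0 // col_c0 prednK.
rewrite /above_meets def_nw /=; apply: (up_closed_dominates U_up cU).
  by rewrite row_c0.
by rewrite col_c0 -ltnS prednK.
Qed.

(** The points of the lattice path that separates [U] from its complement. *)
Definition boundary U : {set L} := [set x | below_in U x && ~~ above_meets U x].

Lemma above_meets_below_in U x : up_closed U -> above_meets U x -> below_in U x.
Proof.
move=> U_up /(above_meetsP _ U_up)[c [cU le_Yc lt_cX]].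
apply/(below_inP _ U_up) => c' lt_c'Y le_Xc'.
apply: (up_closed_dominates U_up cU); lia.
Qed.

(** If [y] were strictly to the lower right of [x], the cell in the row just above
    [y] and the column just right of [x] would lie in [U] because of [x] and
    outside [U] because of [y]. *)
Lemma boundary_is_chain U : up_closed U -> is_chain (boundary U).
Proof.
move=> U_up.
have crossing x y : x \in boundary U -> y \in boundary U ->
    (X x < X y)%N -> (Y y < Y x)%N -> False.
  rewrite !inE => /andP[/(below_inP _ U_up) xU _] /andP[_ /(above_meetsP _ U_up) yU].
  move=> lt_X lt_Y; apply: yU.
  have lt_Yb : (Y y < b)%N by apply: leq_trans lt_Y (Y_le x).
  have [|c row_c col_c] := @cell_exists (Ordinal lt_Yb) (X x).
    by rewrite mu_le_X //= (leq_trans lt_X) // X_le_lam.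
  by exists c; rewrite xU ?row_c ?col_c.
apply/forallP=> x; apply/implyP=> xC; apply/forallP=> y; apply/implyP=> yC.
rewrite /Order.comparable !leXY.
have := crossing x y xC yC; have := crossing y x yC xC; lia.
Qed.

Definition chain_filter C : {set cell S} :=
  [set c | [exists x in C, (row c < Y x)%N && (X x <= col c)%N]].

Lemma chain_filterP C c :
  reflect (exists x, [/\ x \in C, (row c < Y x)%N & (X x <= col c)%N])
          (c \in chain_filter C).
Proof.
rewrite inE; apply: (iffP existsP) => [[x /and3P[]]|[x [xC rowP colP]]].
  by exists x.
by exists x; rewrite xC rowP.
Qed.

Lemma chain_filter_up C : up_closed (chain_filter C).
Proof.
move=> c c' /chain_filterP[x [xC lt_r le_c]] lt_cc'; apply/chain_filterP; exists x.
by case/orP: lt_cc' => /andP[/eqP <- lt_]; split=> //; lia.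
Qed.

Lemma chain_sub_boundary C : is_chain C -> C \subset boundary (chain_filter C).
Proof.
move=> C_chain; have C_up := @chain_filter_up C; apply/subsetP=> x xC; rewrite inE.
apply/andP; split.
  by apply/(below_inP _ C_up) => c lt_r le_c; apply/chain_filterP; exists x.
apply/(above_meetsP _ C_up) => -[c [/chain_filterP[y [yC lt_ry le_yc]] le_xr lt_cx]].
have /forallP/(_ x)/implyP/(_ xC)/forallP/(_ y)/implyP/(_ yC) := C_chain.
by rewrite /Order.comparable !leXY; lia.
Qed.

Lemma max_chain_boundary C : C \in max_chains L -> boundary (chain_filter C) = C.
Proof.
rewrite inE => /maxsetP[C_chain C_max]; apply: C_max.
  exact/boundary_is_chain/chain_filter_up.
exact: chain_sub_boundary.
Qed.

(** The required point lies on the path at the height of the top edge of [c].  Of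
    the points at this height, not to the right of [c], whose lower right quadrant
    lies in [U], it is the leftmost one: a cell of [U] in its upper left quadrant
    would allow a further step to the left. *)
Lemma boundary_below U c : up_closed U -> c \in U ->
  exists x, [/\ x \in boundary U, (row c < Y x)%N & (X x <= col c)%N].
Proof.
move=> U_up cU; have /andP[mu_c lam_c] := cell_bounds c.
have [x0 X0 Y0] : exists2 x, X x = col c & Y x = (row c).+1.
  apply: XY_onto => [||i le_i|i lt_i]; rewrite ?(ltnW (ltn_ord _)) //.
    by apply: leq_trans mu_c; apply: mu_mono.
  by apply: leq_trans (ltnW lam_c) (lam_mono _); apply: ltnW.
pose ok x := [&& Y x == (row c).+1, (X x <= col c)%N & below_in U x].
have ok0 : ok x0.
  rewrite /ok X0 Y0 eqxx leqnn; apply/(below_inP _ U_up) => c' lt_r le_c.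
  apply: (up_closed_dominates U_up cU); lia.
case: (arg_minnP X ok0) => x /and3P[/eqP Yx Xx x_below] x_min.
exists x; rewrite Yx; split=> //; rewrite inE x_below.
apply/negP => /(above_meetsP _ U_up)[c1 [c1U le_Yc1 lt_c1X]].
have /andP[mu_c1 _] := cell_bounds c1.
have [y Xy Yy] : exists2 y, X y = (X x).-1 & Y y = (row c).+1.
  apply: XY_onto => [||i lt_i|i le_i] //.
  - by have := ltn_ord (col c); lia.
  - by rewrite -ltnS in lt_i; have := mu_mono (i := i) (j := row c1); lia.
  - have := @X_le_lam x i; lia.
have : ok y.
  rewrite /ok Yy eqxx Xy /=; apply/andP; split; first by lia.
  apply/(below_inP _ U_up) => c' lt_r le_c.
  apply: (up_closed_dominates U_up c1U); lia.
by move/x_min; rewrite Xy; lia.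
Qed.

(** Dual to [boundary_below]: the point is the rightmost one, at the height of the
    bottom edge of [c], whose upper left quadrant avoids [U]. *)
Lemma boundary_above U c : up_closed U -> c \notin U ->
  exists x, [/\ x \in boundary U, (Y x <= row c)%N & (col c < X x)%N].
Proof.
move=> U_up cNU; have /andP[mu_c lam_c] := cell_bounds c.
have [x0 X0 Y0] : exists2 x, X x = (col c).+1 & Y x = row c.
  apply: XY_onto => [||i lt_i|i le_i]; rewrite ?(ltnW (ltn_ord _)) //.
    by apply: leqW; apply: leq_trans mu_c; apply: mu_mono; apply: ltnW.
  exact: leq_trans lam_c (lam_mono _).
pose ok x := [&& Y x == row c, (col c < X x)%N & ~~ above_meets U x].
have ok0 : ok x0.
  rewrite /ok X0 Y0 eqxx leqnn; apply/(above_meetsP _ U_up) => -[c' [c'U le_r lt_c]].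
  move/negP: cNU; apply; apply: (up_closed_dominates U_up c'U); lia.
have X_le x : ok x -> (X x <= a)%N.
  case/and3P=> /eqP Yx _ _; apply: leq_trans (lam_le (row c)).
  by apply: X_le_lam; rewrite Yx.
case: (@arg_maxnP _ x0 ok X ok0) => x /and3P[/eqP Yx Xx x_above] x_max.
exists x; rewrite Yx; split=> //; rewrite inE x_above andbT.
rewrite /below_in; case def_c1: (se_cell x) => [c1|] //=.
have [row_c1 col_c1] := se_cellP def_c1.
have /andP[mu_c1 lam_c1] := cell_bounds c1.
apply/negPn/negP => c1NU.
have [y Xy Yy] : exists2 y, X y = (X x).+1 & Y y = row c.
  apply: XY_onto => [||i lt_i|i le_i]; rewrite ?(ltnW (ltn_ord _)) //.
  - by have := ltn_ord (col c1); lia.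
  - by apply: leqW; apply: mu_le_X; rewrite Yx.
  - by rewrite -col_c1; apply: leq_trans lam_c1 (lam_mono _); lia.
have : ok y.
  rewrite /ok Yy eqxx Xy /=; apply/andP; split; first by lia.
  apply/(above_meetsP _ U_up) => -[c' [c'U le_r lt_c]].
  move/negP: c1NU; apply; have [le_c|] := leqP (col c') (col c1); last by lia.
  by apply: (up_closed_dominates U_up c'U) => //; lia.
by move/x_max; rewrite /= Xy; lia.
Qed.

(** A maximal chain containing [boundary U] is the boundary of some filter, and
    the points found in [boundary_below] and [boundary_above] force that filter to
    be [U]. *)
Lemma boundary_max_chain U : up_closed U -> boundary U \in max_chains L.
Proof.
move=> U_up; have [C C_max sUC] := maxset_exists (boundary_is_chain U_up).
have C_up := @chain_filter_up C.
have defC : boundary (chain_filter C) = C by apply: max_chain_boundary; rewrite inE.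
suff -> : U = chain_filter C by rewrite defC inE.
apply/setP=> c; apply/idP/idP => [/(boundary_below U_up)[x [xU lt_r le_c]]|].
  by apply/chain_filterP; exists x; rewrite (subsetP sUC).
apply: contraTT => /(boundary_above U_up)[x [/(subsetP sUC) + le_r lt_c]].
rewrite -{1}defC inE => /andP[_ /(above_meetsP _ C_up) x_above].
by apply/negP=> cC; apply: x_above; exists c.
Qed.

(** The indicator of the path at [x] is the indicator of [U] at [se_cell x] minus
    that at [nw_cell x]; this is stated without subtraction and summed over a
    weighted family of filters. *)
Lemma boundary_sum (I : finType) (m : I -> nat) (U : I -> {set cell S})
    (s : cell S -> nat) (x : L) :
  (forall i, up_closed (U i)) ->
  (forall c, s c = \sum_i m i * (c \in U i))%N ->
  (\sum_i m i * (x \in boundary (U i)) + oapp s 0 (nw_cell x)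
     = oapp s (\sum_i m i) (se_cell x))%N.
Proof.
move=> U_up sE.
have -> : oapp s 0%N (nw_cell x) = (\sum_i m i * above_meets (U i) x)%N.
  rewrite /above_meets; case: (nw_cell x) => [c|] //=.
  by rewrite big1 // => i; rewrite muln0.
have -> : oapp s (\sum_i m i) (se_cell x) = (\sum_i m i * below_in (U i) x)%N.
  rewrite /below_in; case: (se_cell x) => [c|] //=.
  by apply: eq_bigr => i; rewrite muln1.
rewrite -big_split /=; apply: eq_bigr => i _; rewrite -mulnDr inE.
have := @above_meets_below_in (U i) x (U_up i).
by case: (above_meets _ _) => [->|_] //; case: below_in.
Qed.

(** The equation at the upper left corner of [c] expresses [s c] through [e] and
    the value of [s] at a cell in the preceding column, so that [s] is determined
    column by column. *)
Lemma boundary_sum_inj (k : nat) (e : L -> nat) (s s' : cell S -> nat) :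
  (forall x, e x + oapp s 0 (nw_cell x) = oapp s k (se_cell x))%N ->
  (forall x, e x + oapp s' 0 (nw_cell x) = oapp s' k (se_cell x))%N ->
  s =1 s'.
Proof.
move=> es es' c; move: {2}(col c).+1 (ltnSn (col c)) => n.
elim: n c => // n IH c lt_cn; have /andP[mu_c lam_c] := cell_bounds c.
have [x Xx Yx] : exists2 x, X x = col c & Y x = (row c).+1.
  apply: XY_onto => [||i le_i|i lt_i]; rewrite ?(ltnW (ltn_ord _)) //.
    by apply: leq_trans mu_c; apply: mu_mono.
  by apply: leq_trans (ltnW lam_c) (lam_mono _); apply: ltnW.
have def_c : se_cell x = Some c by apply: se_cellE.
have := es x; have := es' x; rewrite def_c /= => <- <-; congr (_ + _)%N.
case def_c': (nw_cell x) => [c'|] //=; apply: IH.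
by have [_] := nw_cellP def_c'; rewrite Xx => ->.
Qed.

Definition level k (s : {ffun cell S -> 'I_k.+1}) (t : nat) : {set cell S} :=
  [set c | (t < s c)%N].

Lemma level_up k (s : {ffun cell S -> 'I_k.+1}) (t : nat) :
  s \in order_maps (@cell_lt a b S) k -> up_closed (level s t).
Proof.
rewrite inE => /forallP s_mono c c'; rewrite !inE => lt_t lt_cc'.
have /forallP/(_ c')/implyP/(_ lt_cc') := s_mono c; exact: leq_trans.
Qed.

(** The factor 1 is the weight of each level in [boundary_sum]. *)
Lemma sum_level k (s : {ffun cell S -> 'I_k.+1}) c :
  s c = (\sum_(t < k) 1 * (c \in level s t))%N :> nat.
Proof.
have le_sk : (s c <= k)%N by rewrite -ltnS.
rewrite -[LHS](card_ord_lt le_sk) -sum1dep_card big_mkcond.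
by apply: eq_bigr => t _; rewrite mul1n inE; case: ltnP.
Qed.

Definition level_exponent k (s : {ffun cell S -> 'I_k.+1}) : 'X_{1..#|L|} :=
  [multinom (\sum_(t < k) (enum_val y \in boundary (level s t)))%N | y < #|L|].

Lemma level_exponentE k (s : {ffun cell S -> 'I_k.+1}) (x : L) :
  s \in order_maps (@cell_lt a b S) k ->
  (level_exponent s (enum_rank x) + oapp (fun c => s c : nat) 0 (nw_cell x)
     = oapp (fun c => s c : nat) k (se_cell x))%N.
Proof.
move=> s_mono; have up (t : 'I_k) : up_closed (level s t) by apply: level_up.
have := boundary_sum x up (sum_level s).
rewrite sum_nat_const card_ord muln1 mnmE enum_rankK => <-; congr (_ + _)%N.
by apply: eq_bigr => t _; rewrite mul1n.
Qed.

Lemma level_exponent_inj k :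
  {in order_maps (@cell_lt a b S) k &, injective (@level_exponent k)}.
Proof.
move=> s s' s_mono s'_mono eq_e; apply/ffunP=> c; apply: val_inj.
pose e x := level_exponent s (enum_rank x).
apply: (@boundary_sum_inj k e (fun c => s c) (fun c => s' c)) => x.
  exact: level_exponentE.
by rewrite /e eq_e; apply: level_exponentE.
Qed.

(** The chains in a product need not be nested; replacing them by the boundaries of
    the superlevel sets of the sum of their filters straightens the product into
    one of nested chains with the same exponent. *)
Lemma chain_product_exponent k (m : 'X_{1..#|max_chains L|}) : mdeg m = k ->
  exists2 s, s \in order_maps (@cell_lt a b S) k &
    (\sum_i chain_exponent (enum_val i) *+ m i)%MM = level_exponent s.
Proof.
move=> deg_m; pose U (i : 'I_#|max_chains L|) := chain_filter (enum_val i).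
pose s c := (\sum_i m i * (c \in U i))%N.
have s_le c : (s c < k.+1)%N.
  rewrite ltnS -deg_m mdegE; apply: leq_sum => i _.
  by case: (c \in U i); rewrite ?muln1 ?muln0.
pose sk : {ffun cell S -> 'I_k.+1} := [ffun c => Ordinal (s_le c)].
have sk_mono : sk \in order_maps (@cell_lt a b S) k.
  rewrite inE; apply/forallP=> c; apply/forallP=> c'; apply/implyP=> lt_cc'.
  rewrite !ffunE; apply: leq_sum => i _; rewrite leq_mul2l orbC.
  by case cU: (c \in U i); rewrite // (chain_filter_up cU lt_cc').
exists sk => //; apply/mnmP=> y; rewrite mnm_sumE.
have U_up i : up_closed (U i) by apply: chain_filter_up.
have -> : (\sum_i (chain_exponent (enum_val i) *+ m i)%MM y
    = \sum_i m i * (enum_val y \in boundary (U i)))%N.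
  apply: eq_bigr => i _.
  by rewrite mulmnE mnmE mulnC max_chain_boundary ?enum_valP.
apply: (@addIn (oapp s 0%N (nw_cell (enum_val y)))).
rewrite (boundary_sum (enum_val y) U_up (fun c => erefl (s c))) -mdegE deg_m.
have := level_exponentE (enum_val y) sk_mono; rewrite enum_valK.
by case: (nw_cell _) => [c|]; case: (se_cell _) => [c'|] /=; rewrite ?ffunE /= => ->.
Qed.

Lemma level_product (K : fieldType) k (s : {ffun cell S -> 'I_k.+1}) :
  s \in order_maps (@cell_lt a b S) k ->
  chain_algebra_component k ('X_[level_exponent s] : {mpoly K[#|L|]}).
Proof.
move=> s_mono.
have bdP (t : 'I_k) : boundary (level s t) \in max_chains L.
  exact/boundary_max_chain/level_up.
pose idx (t : 'I_k) := enum_rank_in (bdP t) (boundary (level s t)).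
exists (\prod_(t < k) 'X_(idx t)).
  rewrite mprodXE dhomogX /= mdeg_sum; apply/eqP.
  by under eq_bigr do rewrite mdeg1; rewrite sum1_card card_ord.
rewrite rmorph_prod /=; under eq_bigr => t _ do
  rewrite comp_mpolyXU -tnth_nth tnth_mktuple enum_rankK_in // chain_monomialE.
rewrite mprodXE; congr 'X_[_]; apply/mnmP => y; rewrite mnmE mnm_sumE.
by apply: eq_bigr => t _; rewrite mnmE.
Qed.

Theorem chain_component_dim (K : fieldType) (k : nat) :
  has_dim (@chain_algebra_component K dL L k) #|order_maps (@cell_lt a b S) k|.
Proof.
apply: (monomial_component_dim (w := fun i => chain_exponent (enum_val i))
  (B := fun j => level_exponent (enum_val j))) => [i|j j'|j|m deg_m].
- by rewrite tnth_mktuple chain_monomialE.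
- by move/level_exponent_inj => /(_ (enum_valP j) (enum_valP j')); apply: enum_val_inj.
- by have [F] := level_product K (enum_valP j); exists F.
have [s s_mono ->] := chain_product_exponent deg_m.
by exists (enum_rank_in s_mono s); rewrite enum_rankK_in.
Qed.

End ChainsAndFilters.

(** * Coordinates on the ideals of a union of two chains *)

Section PlanarCoordinates.
Variables (dL dP : Order.disp_t) (L : finTBDistrLatticeType dL) (P : finPOrderType dP).
Variables (f : L -> {set P}) (a b : nat) (alpha : 'I_a -> P) (beta : 'I_b -> P).
Hypotheses (Lf : iso_ideal_lattice f) (P_AB : chain_partition alpha beta).

Lemma in_principal_ideal (p q : P) : (q \in principal_ideal p) = (q <= p)%O.
Proof.
apply/bigcapP/idP => [inI|le_qp I /andP[/forallP I_ideal pI]].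
  have := inI [set r | (r <= p)%O]; rewrite !inE lexx andbT; apply.
  apply/forallP=> r; apply/implyP; rewrite inE => le_rp; apply/forallP=> r'.
  by apply/implyP => le_r'r; rewrite inE (le_trans le_r'r).
by have /implyP/(_ pI)/forallP/(_ q)/implyP := I_ideal p; apply.
Qed.

Lemma down_closed_ltE (n : nat) (p : pred 'I_n) :
  (forall i j : 'I_n, (i <= j)%N -> p j -> p i) ->
  forall i : 'I_n, p i = (i < #|[set j | p j]|)%N.
Proof.
move=> p_down i; apply/idP/idP => [pi|]; last first.
  apply: contraTT => npi; rewrite -leqNgt -[X in (_ <= X)%N](card_ord_lt (ltnW (ltn_ord i))).
  apply/subset_leq_card/subsetP=> j; rewrite !inE ltnNge; apply: contraL.
  by move/p_down=> h; apply: contra npi.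
rewrite -[X in (X <= _)%N](card_ord_lt (ltn_ord i)).
by apply/subset_leq_card/subsetP=> j; rewrite !inE ltnS => /p_down; apply.
Qed.

(** Inequalities between the numbers [skew_mu], [skew_lambda] and the coordinates
    are reduced by this to inclusions between sets of elements of [P]. *)
Lemma leq_by_ords (n p q : nat) : (p <= n)%N ->
  (forall i : 'I_n, (i < p)%N -> (i < q)%N) -> (p <= q)%N.
Proof.
move=> le_pn lt_pq; rewrite leqNgt; apply/negP=> lt_qp.
by have := lt_pq (Ordinal (leq_trans lt_qp le_pn)) lt_qp; rewrite /= ltnn.
Qed.

Lemma alpha_mono (k l : 'I_a) : (k <= l)%N -> (alpha k <= alpha l)%O.
Proof.
have [alpha_lt _ _ _] := P_AB; rewrite leq_eqVlt => /predU1P[/val_inj -> //|].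
by move/alpha_lt/ltW.
Qed.

Lemma beta_mono (i j : 'I_b) : (i <= j)%N -> (beta i <= beta j)%O.
Proof.
have [_ beta_lt _ _] := P_AB; rewrite leq_eqVlt => /predU1P[/val_inj -> //|].
by move/beta_lt/ltW.
Qed.

Lemma alpha_inj : injective alpha.
Proof.
have [alpha_lt _ _ _] := P_AB; move=> k l eq_kl; apply: val_inj.
by case: (ltngtP k l) => // /alpha_lt; rewrite eq_kl ltxx.
Qed.

Lemma beta_inj : injective beta.
Proof.
have [_ beta_lt _ _] := P_AB; move=> k l eq_kl; apply: val_inj.
by case: (ltngtP k l) => // /beta_lt; rewrite eq_kl ltxx.
Qed.

Lemma lt_skew_mu (i : 'I_b) (k : 'I_a) :
  (k < skew_mu alpha beta i)%N = (alpha k <= beta i)%O.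
Proof.
have -> : skew_mu alpha beta i = #|[set l | (alpha l <= beta i)%O]|.
  rewrite -(card_imset _ alpha_inj); apply: eq_card => p; rewrite inE in_principal_ideal.
  apply/andP/imsetP => [[/imsetP[l _ ->] le_l]|[l + ->]]; first by exists l; rewrite ?inE.
  by rewrite inE => le_l; rewrite imset_f.
rewrite -(@down_closed_ltE _ (fun l => (alpha l <= beta i)%O)) // => l l' le_ll'.
exact/le_trans/alpha_mono.
Qed.

Lemma lt_skew_lambda (i : 'I_b) (k : 'I_a) :
  (k < skew_lambda alpha beta i)%N = ~~ (beta i <= alpha k)%O.
Proof.
rewrite ltnNge; congr negb; apply/bigmax_leqP/idP => [le_k|le_ik l].
  by apply: contraT => nle; have := le_k k; rewrite in_principal_ideal ltnn; apply.
rewrite in_principal_ideal ltnNge; apply: contra => le_kl.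
exact: le_trans le_ik (alpha_mono le_kl).
Qed.

Lemma skew_mu_le (i : 'I_b) : (skew_mu alpha beta i <= a)%N.
Proof.
rewrite -[X in (_ <= X)%N](card_ord a) -(card_imset _ alpha_inj).
exact/subset_leq_card/subsetIl.
Qed.

Lemma skew_lambda_le (i : 'I_b) : (skew_lambda alpha beta i <= a)%N.
Proof. by apply/bigmax_leqP=> k _. Qed.

Lemma skew_mu_mono (i j : 'I_b) : (i <= j)%N ->
  (skew_mu alpha beta i <= skew_mu alpha beta j)%N.
Proof.
move=> le_ij; apply: leq_by_ords (skew_mu_le i) _ => k; rewrite !lt_skew_mu => le_k.
exact: le_trans le_k (beta_mono le_ij).
Qed.

Lemma skew_lambda_mono (i j : 'I_b) : (i <= j)%N ->
  (skew_lambda alpha beta i <= skew_lambda alpha beta j)%N.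
Proof.
move=> le_ij; apply: leq_by_ords (skew_lambda_le i) _ => k; rewrite !lt_skew_lambda.
by apply: contra; apply: le_trans (beta_mono le_ij).
Qed.

Definition abscissa (x : L) : nat := #|[set k | alpha k \in f x]|.
Definition ordinate (x : L) : nat := #|[set i | beta i \in f x]|.

Lemma ideal_down (x : L) (p q : P) : (p <= q)%O -> q \in f x -> p \in f x.
Proof.
move=> le_pq qI; have [f_ideal _ _] := Lf.
by have /forallP/(_ q)/implyP/(_ qI)/forallP/(_ p)/implyP := f_ideal x; apply.
Qed.

Lemma lt_abscissa (x : L) (k : 'I_a) : (k < abscissa x)%N = (alpha k \in f x).
Proof.
rewrite -(@down_closed_ltE _ (fun k => alpha k \in f x)) // => l l' /alpha_mono.
exact: ideal_down.
Qed.

Lemma lt_ordinate (x : L) (i : 'I_b) : (i < ordinate x)%N = (beta i \in f x).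
Proof.
rewrite -(@down_closed_ltE _ (fun i => beta i \in f x)) // => l l' /beta_mono.
exact: ideal_down.
Qed.

Lemma abscissa_le (x : L) : (abscissa x <= a)%N.
Proof. by rewrite -[X in (_ <= X)%N](card_ord a) max_card. Qed.

Lemma ordinate_le (x : L) : (ordinate x <= b)%N.
Proof. by rewrite -[X in (_ <= X)%N](card_ord b) max_card. Qed.

Lemma le_coordinates (x y : L) :
  (x <= y)%O = (abscissa x <= abscissa y)%N && (ordinate x <= ordinate y)%N.
Proof.
have [_ _ <-] := Lf; have [_ _ _ P_cover] := P_AB; apply/subsetP/andP => [sub_xy|[leX leY] p].
  split.
    by apply: leq_by_ords (abscissa_le x) _ => k; rewrite !lt_abscissa => /sub_xy.
  by apply: leq_by_ords (ordinate_le x) _ => k; rewrite !lt_ordinate => /sub_xy.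
have [[k ->]|[i ->]] := P_cover p.
  by rewrite -!lt_abscissa => /leq_trans; apply.
by rewrite -!lt_ordinate => /leq_trans; apply.
Qed.

Lemma skew_mu_le_abscissa (x : L) (i : 'I_b) :
  (i < ordinate x)%N -> (skew_mu alpha beta i <= abscissa x)%N.
Proof.
rewrite lt_ordinate => ix; apply: leq_by_ords (skew_mu_le i) _ => k.
by rewrite lt_skew_mu lt_abscissa => /ideal_down; apply.
Qed.

Lemma abscissa_le_skew_lambda (x : L) (i : 'I_b) :
  (ordinate x <= i)%N -> (abscissa x <= skew_lambda alpha beta i)%N.
Proof.
rewrite leqNgt lt_ordinate => ix; apply: leq_by_ords (abscissa_le x) _ => k.
rewrite lt_skew_lambda lt_abscissa => kx.
by apply: contra ix => /ideal_down; apply.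
Qed.

(** The elements [alpha k], k < p, and [beta i], i < q, form an ideal: the bounds on
    [p] are the order relations between the two chains, read through
    [lt_skew_mu] and [lt_skew_lambda]. *)
Lemma coordinates_onto (p q : nat) : (p <= a)%N -> (q <= b)%N ->
  (forall i : 'I_b, (i < q)%N -> (skew_mu alpha beta i <= p)%N) ->
  (forall i : 'I_b, (q <= i)%N -> (p <= skew_lambda alpha beta i)%N) ->
  exists2 x, abscissa x = p & ordinate x = q.
Proof.
move=> le_pa le_qb mu_le lam_ge; have [_ _ disj P_cover] := P_AB.
have [_ f_onto _] := Lf.
pose I := [set r | [exists k : 'I_a, (r == alpha k) && (k < p)%N]
                || [exists i : 'I_b, (r == beta i) && (i < q)%N]].
have alphaI k : (alpha k \in I) = (k < p)%N.
  rewrite inE; apply/orP/idP => [[/existsP[l]|/existsP[i]]|lt_kp].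
  - by case/andP=> /eqP/alpha_inj ->.
  - by rewrite (negbTE (disj k i)).
  by left; apply/existsP; exists k; rewrite eqxx.
have betaI i : (beta i \in I) = (i < q)%N.
  rewrite inE; apply/orP/idP => [[/existsP[k]|/existsP[j]]|lt_iq].
  - by rewrite eq_sym (negbTE (disj k i)).
  - by case/andP=> /eqP/beta_inj ->.
  by right; apply/existsP; exists i; rewrite eqxx.
have I_ideal : is_ideal I.
  apply/forallP=> r; apply/implyP=> rI; apply/forallP=> s; apply/implyP=> le_sr.
  case: (P_cover r) (P_cover s) rI le_sr => [[k ->]|[i ->]] [[l ->]|[j ->]];
    rewrite ?alphaI ?betaI => lt_r le_sr.
  - apply: leq_ltn_trans lt_r; rewrite leqNgt; apply/negP.
    by have [alpha_lt _ _ _] := P_AB => /alpha_lt/lt_geF; rewrite le_sr.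
  - rewrite ltnNge; apply/negP=> /lam_ge /(leq_trans lt_r).
    by rewrite lt_skew_lambda le_sr.
  - by apply: leq_trans (mu_le _ lt_r); rewrite lt_skew_mu.
  apply: leq_ltn_trans lt_r; rewrite leqNgt; apply/negP.
  by have [_ beta_lt _ _] := P_AB => /beta_lt/lt_geF; rewrite le_sr.
have [x fx] := f_onto I I_ideal; exists x; apply/eqP; rewrite eqn_leq; apply/andP; split.
- by apply: leq_by_ords (abscissa_le x) _ => k; rewrite lt_abscissa fx alphaI.
- by apply: leq_by_ords le_pa _ => k; rewrite lt_abscissa fx alphaI.
- by apply: leq_by_ords (ordinate_le x) _ => k; rewrite lt_ordinate fx betaI.
by apply: leq_by_ords le_qb _ => k; rewrite lt_ordinate fx betaI.
Qed.

Lemma planar_component_dim (K : fieldType) (k : nat) :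
  has_dim (@chain_algebra_component K dL L k)
          #|order_maps (@cell_lt a b (skew_shape alpha beta)) k|.
Proof.
apply: (chain_component_dim le_coordinates ordinate_le skew_mu_le_abscissa
  abscissa_le_skew_lambda coordinates_onto skew_mu_mono skew_lambda_mono skew_lambda_le).
by move=> i j; rewrite inE.
Qed.

End PlanarCoordinates.

(** * Standard tableaux as linear extensions *)

Section ReadingOrder.
Variables (a b : nat) (S : {set 'I_b * 'I_a}).

(** The cells are read from the top row, which has the largest index, to the
    bottom row, and from left to right in each row. *)
Definition reading_label (c : cell S) : nat := (rev_ord (cell_row c) * a + cell_col c)%N.

Lemma reading_label_lt (c c' : cell S) :
  (reading_label c < reading_label c')%N =
  (cell_row c' < cell_row c)%N
  || (cell_row c == cell_row c') && (cell_col c < cell_col c')%N.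
Proof.
rewrite /reading_label /= -val_eqE /=.
have := ltn_ord (cell_col c); have := ltn_ord (cell_col c').
have := ltn_ord (cell_row c); have := ltn_ord (cell_row c').
case: (ltngtP (cell_row c) (cell_row c')) => [lt_r|gt_r|->] /=; nia.
Qed.

Lemma reading_label_inj : injective reading_label.
Proof.
move=> c c' eq_l; have := reading_label_lt c c'; have := reading_label_lt c' c.
rewrite eq_l ltnn => /esym/norP[r1 c1] /esym/norP[r2 c2].
have eq_r : cell_row c = cell_row c' by apply: val_inj => /=; lia.
move: c1 c2; rewrite eq_r eqxx /= => c1 c2.
have eq_c : cell_col c = cell_col c' by apply: val_inj => /=; lia.
apply: val_inj; rewrite (surjective_pairing (val c)) (surjective_pairing (val c')).
by congr (_, _).
Qed.

Lemma reading_label_natural (c c' : cell S) :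
  cell_lt c c' -> (reading_label c < reading_label c')%N.
Proof. by rewrite reading_label_lt => /orP[->|/andP[_ ->]]; rewrite ?orbT. Qed.

Lemma card_cell : #|cell S| = #|S|.
Proof. by rewrite card_sig; apply: eq_card => c. Qed.

Lemma is_SYT_linear_extension (T : filling S) :
  is_SYT T = linear_extension (@cell_lt a b S) T.
Proof.
apply/and4P/andP => [[T_inj _ T_row T_col]|[T_inj T_mono]]; split=> //.
- apply/forallP=> c; apply/forallP=> c'; apply/implyP=> /orP[lt_cc'|lt_cc'].
    by have /forallP/(_ c)/forallP/(_ c')/implyP/(_ lt_cc') := T_row.
  by have /forallP/(_ c)/forallP/(_ c')/implyP/(_ lt_cc') := T_col.
- apply/forallP; apply: inj_card_onto; first exact/injectiveP.
  by rewrite card_ord card_cell.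
- apply/forallP=> c; apply/forallP=> c'; apply/implyP=> lt_cc'.
  by have /forallP/(_ c)/forallP/(_ c')/implyP := T_mono; apply; rewrite /cell_lt lt_cc'.
apply/forallP=> c; apply/forallP=> c'; apply/implyP=> lt_cc'.
by have /forallP/(_ c)/forallP/(_ c')/implyP := T_mono; apply; rewrite /cell_lt lt_cc' orbT.
Qed.

(** A successor of smaller label lies in a higher row, or further left in the same
    row; the latter contradicts the increase along rows. *)
Lemma asc_descents (T : filling S) :
  is_SYT T -> asc T = #|descents reading_label T|.
Proof.
rewrite is_SYT_linear_extension => /andP[_ /forallP T_mono].
apply: eq_card => v; rewrite !inE; apply: eq_existsb => c; apply: eq_existsb => c'.
case: eqP => //= Tc; case: eqP => //= Tc'; rewrite reading_label_lt.
case: ltnP => //= le_r; apply/esym/negbTE/negP => /andP[eq_r lt_c].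
have /forallP/(_ c)/implyP := T_mono c'; rewrite /cell_lt eq_r lt_c Tc Tc' => /(_ isT).
by rewrite ltnNge leqnSn.
Qed.

End ReadingOrder.

(** * The Hilbert series *)

Theorem theorem3p10 (K : fieldType)
    (dL dP : Order.disp_t) (L : finTBDistrLatticeType dL) (P : finPOrderType dP)
    (f : L -> {set P}) (Lf : iso_ideal_lattice f)
    (planarL : (width P <= 2)%N)
    (a b : nat) (alpha : 'I_a -> P) (beta : 'I_b -> P)
    (P_AB : chain_partition alpha beta) :
  let shape := skew_shape alpha beta in
  let d := #|shape| in
  exists H : nat -> nat,
    chain_hilbert_function K L H /\
    power_series_eq_frac H
      (\sum_(T : filling shape | is_SYT T) 'X^(asc T))
      ((1 - 'X) ^+ d.+1).
Proof.
move=> shape d; exists (fun k => #|order_maps (@cell_lt a b shape) k|); split.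
  by move=> k; apply: planar_component_dim Lf P_AB K k.
move=> k; rewrite coef_sum.
have hilb i : #|order_maps (@cell_lt a b shape) i|%:Z
    = \sum_(T : filling shape | is_SYT T) 'C(i + d - asc T, d)%:Z.
  rewrite (card_order_maps (card_cell shape) (@reading_label_inj a b shape)
    (@reading_label_natural a b shape)) -natz natr_sum.
  apply: eq_big => [T|T T_SYT]; first by rewrite is_SYT_linear_extension.
  by rewrite natz asc_descents // is_SYT_linear_extension.
under eq_bigr do rewrite hilb mulr_suml.
(* Each tableau contributes the coefficients of z ^ (asc T) separately. *)
rewrite exchange_big /=; apply: eq_bigr => T _.
rewrite binomial_series_frac; last by rewrite -[X in (_ <= X)%N](card_ord d) max_card.
by rewrite coefXn natz.
Qed.
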